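(* Let $\Phi\subset\mathbb{R}^3$ be a ruled $C^3$-surface, free of torsal rulings, which is relatively normalized by ${}^{(\alpha)}\bar y$ for some $\alpha\in\mathbb{R}$. If the relative normals of $\Phi$ are parallel to a fixed plane (i.e. there is a constant vector $\bar c\neq\bar 0$ with $\langle {}^{(\alpha)}\bar y(u,v),\bar c\rangle=0$ for all $(u,v)\in I\times\mathbb{R}$), then $\alpha=1/4$ and $\Phi$ is a conoidal surface.
   Context: Ruled surfaces. Let $I\subset\mathbb{R}$ be an open interval and $U=I\times\mathbb{R}$. A ruled surface $\Phi$ free of torsal rulings is parametrized over $U$ by the (injective) immersion $\bar x(u,v)=\bar s(u)+v\,\bar e(u)$ with $|\bar e|=|\bar e'|=1$ and $\langle\bar s',\bar e'\rangle=0$ on $I$ (so $\bar s$ is the line of striction, $u$ is arc length of the spherical curve $\bar e$); a prime denotes $d/du$. For a $C^3$-surface $\bar s,\bar e$ are of class $C^3$. The moving frame is $\bar e$, $\bar n=\bar e'$, $\bar z=\bar e\times\bar n$. The fundamental invariants are: conical curvature $\kappa=\det(\bar e,\bar e',\bar e'')$, parameter of distribution $\delta=\det(\bar s',\bar e,\bar e')$, and $\lambda$, defined by $\bar s'=\delta(\lambda\bar e+\bar z)$. Free of torsal rulings (skew) means $\delta(u)\ne0$ for all $u\in I$. $\Phi$ is called conoidal if $\kappa\equiv0$ on $I$. Relative normalization. Put $u^1=u$, $u^2=v$. Let $\bar\xi=(\bar x_u\times\bar x_v)/|\bar x_u\times\bar x_v|$ be the Euclidean unit normal, $h_{ij}=\langle\bar\xi,\partial^2\bar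 x/\partial u^i\partial u^j\rangle$ the second fundamental form with inverse $h^{(ij)}$, and $K$ the Gaussian curvature ($K=-\delta^2/(v^2+\delta^2)^2\neq0$). For $\alpha\in\mathbb{R}$ the support function is ${}^{(\alpha)}q=|K|^\alpha$, and the relative normalization it determines is $${}^{(\alpha)}\bar y=-h^{(ij)}\frac{\partial\,{}^{(\alpha)}q}{\partial u^i}\frac{\partial\bar x}{\partial u^j}+{}^{(\alpha)}q\,\bar\xi$$ (summation over repeated indices). The relative normals are the lines through $\bar x(u,v)$ with direction ${}^{(\alpha)}\bar y(u,v)$. *)

(* Defs.v *)
(* Stdlib real numbers with Coquelicot.  Vectors of R^3 are triples, with the
   addition [plus], scaling [scal] and origin [zero] that Coquelicot puts on
   products. *)
From Stdlib Require Import Reals.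
From Coquelicot Require Import Coquelicot.
Open Scope R_scope.

Definition R3 : Type := (R * R * R)%type.

Definition cx (p : R3) : R := fst (fst p).
Definition cy (p : R3) : R := snd (fst p).
Definition cz (p : R3) : R := snd p.

Definition dot (p q : R3) : R := cx p * cx q + cy p * cy q + cz p * cz q.

Definition cross (p q : R3) : R3 :=
  (cy p * cz q - cz p * cy q,
   cz p * cx q - cx p * cz q,
   cx p * cy q - cy p * cx q).

Definition det3 (p q r : R3) : R := dot p (cross q r).

Definition enorm (p : R3) : R := sqrt (dot p p).

(* Derivatives are Coquelicot's total [Derive].  Everything below is evaluated
   only at points of an open interval, so values outside it are irrelevant. *)
Definition cderive (c : R -> R3) (u : R) : R3 :=
  (Derive (fun t => cx (c t)) u,
   Derive (fun t => cy (c t)) u,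
   Derive (fun t => cz (c t)) u).

Definition class_C (n : nat) (D : R -> Prop) (f : R -> R) : Prop :=
  forall u : R, D u -> forall k : nat, (k <= n)%nat ->
    ex_derive_n f k u /\ continuous (Derive_n f k) u.

Definition curve_class_C (n : nat) (D : R -> Prop) (c : R -> R3) : Prop :=
  class_C n D (fun t => cx (c t)) /\
  class_C n D (fun t => cy (c t)) /\
  class_C n D (fun t => cz (c t)).

(* The endpoints may be infinite. *)
Definition between_Rbar (a b : Rbar) (u : R) : Prop :=
  Rbar_lt a u /\ Rbar_lt u b.

(* The two parameters: U1 stands for u^1 = u and U2 for u^2 = v. *)
Inductive param : Set := U1 | U2.

Definition psum {G : AbelianMonoid} (F : param -> G) : G := plus (F U1) (F U2).

Definition partial (i : param) (f : R -> R -> R) (u v : R) : R :=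
  match i with
  | U1 => Derive (fun t => f t v) u
  | U2 => Derive (fun t => f u t) v
  end.

Definition vpartial (i : param) (f : R -> R -> R3) (u v : R) : R3 :=
  (partial i (fun r t => cx (f r t)) u v,
   partial i (fun r t => cy (f r t)) u v,
   partial i (fun r t => cz (f r t)) u v).

Definition pdet (A : param -> param -> R) : R :=
  A U1 U1 * A U2 U2 - A U1 U2 * A U2 U1.

Definition pinv (A : param -> param -> R) (i j : param) : R :=
  match i, j with
  | U1, U1 => A U2 U2 / pdet A
  | U1, U2 => - A U1 U2 / pdet A
  | U2, U1 => - A U2 U1 / pdet A
  | U2, U2 => A U1 U1 / pdet A
  end.

Definition pid (i j : param) : R :=
  match i, j with U1, U1 | U2, U2 => 1 | _, _ => 0 end.

Lemma pinv_r (A : param -> param -> R) : pdet A <> 0 ->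
  forall i k, psum (fun j => A i j * pinv A j k : R_AbelianMonoid) = pid i k.
Proof.
  intros HA i k; unfold pdet in HA.
  destruct i, k; unfold psum, pinv, pid, plus, pdet; simpl; field; exact HA.
Qed.

Section Surface.
Variable x : R -> R -> R3.

Definition normal_vec (u v : R) : R3 :=
  cross (vpartial U1 x u v) (vpartial U2 x u v).

Definition unit_normal (u v : R) : R3 :=
  scal (/ enorm (normal_vec u v)) (normal_vec u v).

Definition first_form (u v : R) (i j : param) : R :=
  dot (vpartial i x u v) (vpartial j x u v).

Definition second_form (u v : R) (i j : param) : R :=
  dot (unit_normal u v) (vpartial i (vpartial j x) u v).

Definition gauss_curvature (u v : R) : R :=
  pdet (second_form u v) / pdet (first_form u v).

(* [Rpower] is the real power only for a positive base: this is |K|^alpha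
   where K is nonzero, as it is on every skew ruled surface. *)
Definition support (alpha : R) (u v : R) : R :=
  Rpower (Rabs (gauss_curvature u v)) alpha.

Definition relative_normal (alpha : R) (u v : R) : R3 :=
  plus
    (opp (psum (fun i => psum (fun j =>
       scal (pinv (second_form u v) i j * partial i (support alpha) u v)
            (vpartial j x u v)))))
    (scal (support alpha u v) (unit_normal u v)).

End Surface.

Definition ruled (s e : R -> R3) (u v : R) : R3 := plus (s u) (scal v (e u)).

Definition conical_curvature (e : R -> R3) (u : R) : R :=
  det3 (e u) (cderive e u) (cderive (cderive e) u).

Definition distribution (s e : R -> R3) (u : R) : R :=
  det3 (cderive s u) (e u) (cderive e u).

(* s is the line of striction and u the arc length of the spherical curve e. *)
Record skew_ruled_C3 (D : R -> Prop) (s e : R -> R3) : Prop := {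
  skew_C3_s : curve_class_C 3 D s;
  skew_C3_e : curve_class_C 3 D e;
  skew_unit : forall u, D u -> enorm (e u) = 1;
  skew_arc : forall u, D u -> enorm (cderive e u) = 1;
  skew_striction : forall u, D u -> dot (cderive s u) (cderive e u) = 0;
  skew_immersion : forall u v, D u -> forall p q : R,
    plus (scal p (vpartial U1 (ruled s e) u v))
         (scal q (vpartial U2 (ruled s e) u v)) = zero -> p = 0 /\ q = 0;
  skew_injective : forall u v u' v', D u -> D u' ->
    ruled s e u v = ruled s e u' v' -> u = u' /\ v = v';
  skew_nontorsal : forall u, D u -> distribution s e u <> 0
}.

Definition conoidal (D : R -> Prop) (e : R -> R3) : Prop :=
  forall u, D u -> conical_curvature e u = 0.

Definition normals_parallel_to_plane (D : R -> Prop) (x : R -> R -> R3)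
    (alpha : R) : Prop :=
  exists c : R3, c <> zero /\
    forall u v, D u -> dot (relative_normal x alpha u v) c = 0.

(* Main.v *)
Require Import Defs.
From Stdlib Require Import Reals Lra Lia.
From Coquelicot Require Import Coquelicot.
Open Scope R_scope.

(** Write [n = e'], [z = e x n], and [c1, c2, c3] for the components [e.c],
    [n.c], [z.c] of the fixed vector c in the moving frame.  The frame equation
    [n' = - e + kappa z] and [s' = delta (lambda e + z)] make the fundamental
    forms explicit, with [w = sqrt (v^2 + delta^2)] the length of
    [x_u x x_v = delta n - v z]; in particular [|K| = delta^2 / w^4].
    Inserting these in the definition of the relative normal y gives
    ([dot_relative_normal])

      [y.c = q / (delta^2 w) * P(v)], where
      [P(v) = 2 alpha (v^2 + delta^2) (delta' + 2 kappa v) c1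
              + delta (4 alpha v^2 + delta^2) c2
              + delta^2 (4 alpha - 1) v c3].

    The invariant [lambda] has cancelled.  For fixed u the left side vanishes
    for every v exactly when the cubic polynomial P is zero, and comparing
    coefficients ([relative_normal_orthogonal]) yields
    [alpha kappa c1 = 0], [2 alpha delta' c1 + delta c2 = 0],
    [(4 alpha - 1) c2 = 0] and [(4 alpha - 1) c3 = 0].

    If [alpha <> 1/4], then [c2 = c3 = 0] all along the curve; since
    [c2' = - c1 + kappa c3], also [c1 = 0] and c is zero.  So [alpha = 1/4].
    If moreover [kappa <> 0] at some parameter, then by continuity it does not
    vanish nearby, where the first two equations give [c1 = c2 = 0]; the
    derivative of [c2] now gives [kappa c3 = 0], so again c is zero.  Hence
    [kappa] vanishes identically. *)

(** * Vector algebra in the moving frame *)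

Ltac vec_unfold :=
  unfold det3, cross, dot, cx, cy, cz;
  repeat (progress (unfold plus, scal, opp, zero, mult,
                      prod_plus, prod_scal, prod_opp, prod_zero; cbn)).

Lemma R3_eq (p q : R3) : cx p = cx q -> cy p = cy q -> cz p = cz q -> p = q.
Proof.
  destruct p as [[p1 p2] p3], q as [[q1 q2] q3]; cbn.
  now intros -> -> ->.
Qed.

Lemma dot_comm (p q : R3) : dot p q = dot q p.
Proof. unfold dot; ring. Qed.

Lemma dot_plus_l (p q r : R3) : dot (plus p q) r = dot p r + dot q r.
Proof. vec_unfold; ring. Qed.

Lemma dot_scal_l (k : R) (p r : R3) : dot (scal k p) r = k * dot p r.
Proof. vec_unfold; ring. Qed.

Lemma dot_opp_l (p r : R3) : dot (opp p) r = - dot p r.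
Proof. vec_unfold; ring. Qed.

Lemma dot_zero_r (p : R3) : dot p zero = 0.
Proof. vec_unfold; ring. Qed.

Lemma dot_self_eq0 (p : R3) : dot p p = 0 -> p = zero.
Proof.
  unfold dot; intros h; apply R3_eq; vec_unfold; unfold cx, cy, cz in h; nra.
Qed.

Lemma enorm_eq1 (p : R3) : enorm p = 1 -> dot p p = 1.
Proof.
  unfold enorm; intros h.
  assert (h0 : 0 <= dot p p) by (unfold dot; nra).
  rewrite <- (sqrt_sqrt _ h0), h; ring.
Qed.

(** Parseval's identity for the frame e, n, e x n.  For arbitrary e and n the
    polynomial identity [id] holds, which contains the determinant and the
    adjugate of the Gram matrix of e and n; orthonormality makes both trivial. *)
Lemma dot_frame (e n p q : R3) :
  dot e e = 1 -> dot n n = 1 -> dot e n = 0 ->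
  dot p q = dot p e * dot q e + dot p n * dot q n
            + dot p (cross e n) * dot q (cross e n).
Proof.
  intros he hn hen.
  assert (id : (dot e e * dot n n - dot e n * dot e n) * dot p q =
    dot p e * (dot n n * dot q e - dot e n * dot q n)
    + dot p n * (dot e e * dot q n - dot e n * dot q e)
    + dot p (cross e n) * dot q (cross e n)) by (vec_unfold; ring).
  rewrite he, hn, hen in id; lra.
Qed.

Lemma frame_zero (e n p : R3) :
  dot e e = 1 -> dot n n = 1 -> dot e n = 0 ->
  dot p e = 0 -> dot p n = 0 -> dot p (cross e n) = 0 -> p = zero.
Proof.
  intros he hn hen h1 h2 h3; apply dot_self_eq0.
  rewrite (dot_frame e n p p) by assumption; rewrite h1, h2, h3; ring.
Qed.

(** * Differentiation of curves *)

(** The relational counterpart of [cderive]; unlike the total operator it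
    carries differentiability, which the product rules need. *)
Definition is_cderive (c : R -> R3) (u : R) (l : R3) : Prop :=
  is_derive (fun t => cx (c t)) u (cx l) /\
  is_derive (fun t => cy (c t)) u (cy l) /\
  is_derive (fun t => cz (c t)) u (cz l).

(* [is_derive] is itself a conjunction, so [repeat split] would go too deep. *)
Ltac split_components := split; [|split].

Lemma is_cderive_unique (c : R -> R3) (u : R) (l : R3) :
  is_cderive c u l -> cderive c u = l.
Proof.
  intros (h1 & h2 & h3); apply R3_eq; cbn; now apply is_derive_unique.
Qed.

Lemma is_cderive_ext_loc (c d : R -> R3) (u : R) (l : R3) :
  locally u (fun t => c t = d t) -> is_cderive c u l -> is_cderive d u l.
Proof.
  intros h (h1 & h2 & h3); split_components;
    (eapply is_derive_ext_loc; [|eassumption]);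
    (eapply filter_imp; [|exact h]); cbn; intros t ->; reflexivity.
Qed.

Lemma is_cderive_const (p : R3) (u : R) : is_cderive (fun _ => p) u zero.
Proof. split_components; apply @is_derive_const. Qed.

Lemma is_cderive_plus (c d : R -> R3) (u : R) (l m : R3) :
  is_cderive c u l -> is_cderive d u m ->
  is_cderive (fun t => plus (c t) (d t)) u (plus l m).
Proof.
  intros (h1 & h2 & h3) (k1 & k2 & k3); split_components; now apply @is_derive_plus.
Qed.

Lemma is_cderive_scal (k : R) (c : R -> R3) (u : R) (l : R3) :
  is_cderive c u l -> is_cderive (fun t => scal k (c t)) u (scal k l).
Proof. intros (h1 & h2 & h3); split_components; now apply @is_derive_scal. Qed.

Lemma is_cderive_line (p q : R3) (v : R) :
  is_cderive (fun t => plus p (scal t q)) v q.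
Proof.
  split_components; vec_unfold; auto_derive; trivial; ring.
Qed.

Lemma is_derive_mult_R (f g : R -> R) (u l m : R) :
  is_derive f u l -> is_derive g u m ->
  is_derive (fun t => f t * g t) u (l * g u + f u * m).
Proof. intros hf hg; apply (is_derive_mult f g); trivial; apply Rmult_comm. Qed.

Lemma is_derive_dot (c d : R -> R3) (u : R) (l m : R3) :
  is_cderive c u l -> is_cderive d u m ->
  is_derive (fun t => dot (c t) (d t)) u (dot l (d u) + dot (c u) m).
Proof.
  intros (h1 & h2 & h3) (k1 & k2 & k3); unfold dot.
  evar_last.
  - apply @is_derive_plus; [apply @is_derive_plus|];
      apply is_derive_mult_R; eassumption.
  - cbn; unfold plus; cbn; ring.
Qed.

Lemma is_cderive_cross (c d : R -> R3) (u : R) (l m : R3) :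
  is_cderive c u l -> is_cderive d u m ->
  is_cderive (fun t => cross (c t) (d t)) u (plus (cross l (d u)) (cross (c u) m)).
Proof.
  intros (h1 & h2 & h3) (k1 & k2 & k3); split_components; cbn;
  (evar_last;
   [apply @is_derive_minus; apply is_derive_mult_R; eassumption
   |cbn; unfold minus, plus, opp; cbn; ring]).
Qed.

Lemma class_C_is_derive (k : nat) (D : R -> Prop) (f : R -> R) (u : R) :
  class_C 3 D f -> D u -> (k < 3)%nat ->
  is_derive (Derive_n f k) u (Derive_n f (S k) u).
Proof.
  intros h hu hk; apply Derive_correct.
  now destruct (h u hu (S k)) as [hex _].
Qed.

Lemma curve_C3_is_cderive (D : R -> Prop) (c : R -> R3) (u : R) :
  curve_class_C 3 D c -> D u ->
  is_cderive c u (cderive c u) /\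
  is_cderive (cderive c) u (cderive (cderive c) u) /\
  is_cderive (cderive (cderive c)) u (cderive (cderive (cderive c)) u).
Proof.
  intros (h1 & h2 & h3) hu; split; [|split]; split_components.
  - exact (class_C_is_derive 0 D _ u h1 hu ltac:(lia)).
  - exact (class_C_is_derive 0 D _ u h2 hu ltac:(lia)).
  - exact (class_C_is_derive 0 D _ u h3 hu ltac:(lia)).
  - exact (class_C_is_derive 1 D _ u h1 hu ltac:(lia)).
  - exact (class_C_is_derive 1 D _ u h2 hu ltac:(lia)).
  - exact (class_C_is_derive 1 D _ u h3 hu ltac:(lia)).
  - exact (class_C_is_derive 2 D _ u h1 hu ltac:(lia)).
  - exact (class_C_is_derive 2 D _ u h2 hu ltac:(lia)).
  - exact (class_C_is_derive 2 D _ u h3 hu ltac:(lia)).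
Qed.

Lemma is_derive_const_loc (f : R -> R) (k u l : R) :
  locally u (fun t => f t = k) -> is_derive f u l -> l = 0.
Proof.
  intros h hf; rewrite <- (is_derive_unique _ _ _ hf).
  rewrite (Derive_ext_loc f (fun _ => k)) by exact h; apply Derive_const.
Qed.

Lemma is_derive_Rpower (f : R -> R) (al u l : R) :
  is_derive f u l -> 0 < f u ->
  is_derive (fun t => Rpower (f t) al) u (al * (l / f u) * Rpower (f u) al).
Proof.
  intros hf hpos.
  evar_last.
  - apply (is_derive_comp (fun y => Rpower y al) f u); [|exact hf].
    unfold Rpower; auto_derive; [exact hpos | reflexivity].
  - cbn; unfold scal; cbn; unfold mult; cbn; unfold Rpower; field; lra.
Qed.

(** A polynomial of degree at most 3 is determined by its values at the four
    points -1, 0, 1, 2. *)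
Lemma cubic_zero (p0 p1 p2 p3 : R) :
  (forall v, p0 + p1 * v + p2 * v ^ 2 + p3 * v ^ 3 = 0) ->
  p0 = 0 /\ p1 = 0 /\ p2 = 0 /\ p3 = 0.
Proof.
  intros h; pose proof (h 0); pose proof (h 1); pose proof (h (-1));
    pose proof (h 2); repeat split; lra.
Qed.

(** * The moving frame of a skew ruled surface *)

Section SkewRuled.

Variables (D : R -> Prop) (s e : R -> R3).
Hypothesis D_open : open D.
Hypothesis Phi : skew_ruled_C3 D s e.

Let n := cderive e.
Let z (u : R) : R3 := cross (e u) (n u).
Let delta := distribution s e.
Let kappa := conical_curvature e.

Lemma is_cderive_s u : D u -> is_cderive s u (cderive s u).
Proof. intros hu; now apply (curve_C3_is_cderive D s u (skew_C3_s _ _ _ Phi)). Qed.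

Lemma is_cderive_ds u : D u -> is_cderive (cderive s) u (cderive (cderive s) u).
Proof. intros hu; now apply (curve_C3_is_cderive D s u (skew_C3_s _ _ _ Phi)). Qed.

Lemma is_cderive_e u : D u -> is_cderive e u (n u).
Proof. intros hu; now apply (curve_C3_is_cderive D e u (skew_C3_e _ _ _ Phi)). Qed.

Lemma is_cderive_n u : D u -> is_cderive n u (cderive n u).
Proof. intros hu; now apply (curve_C3_is_cderive D e u (skew_C3_e _ _ _ Phi)). Qed.

Lemma is_cderive_dn u : D u -> is_cderive (cderive n) u (cderive (cderive n) u).
Proof. intros hu; now apply (curve_C3_is_cderive D e u (skew_C3_e _ _ _ Phi)). Qed.

Lemma dot_e_e u : D u -> dot (e u) (e u) = 1.
Proof. intros hu; apply enorm_eq1, (skew_unit _ _ _ Phi), hu. Qed.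

Lemma dot_n_n u : D u -> dot (n u) (n u) = 1.
Proof. intros hu; apply enorm_eq1, (skew_arc _ _ _ Phi), hu. Qed.

(** The constancy of [e.e], [n.n], [e.n] and [s'.n] is used through its
    derivatives: they express the components of [e''] and [s''] that occur in
    the second fundamental form. *)
Lemma dot_const_derive (c d : R -> R3) (k u : R) (l m : R3) :
  D u -> (forall t, D t -> dot (c t) (d t) = k) ->
  is_cderive c u l -> is_cderive d u m ->
  dot l (d u) + dot (c u) m = 0.
Proof.
  intros hu hk hc hd.
  apply (is_derive_const_loc (fun t => dot (c t) (d t)) k u).
  - apply (filter_imp D); [exact hk | now apply D_open].
  - now apply is_derive_dot.
Qed.

Lemma dot_e_n u : D u -> dot (e u) (n u) = 0.
Proof.
  intros hu.
  pose proof (dot_const_derive e e 1 u _ _ hu dot_e_e (is_cderive_e u hu) (is_cderive_e u hu)) as h.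
  rewrite (dot_comm (n u)) in h; lra.
Qed.

Lemma dot_frame_at u (p q : R3) : D u ->
  dot p q = dot p (e u) * dot q (e u) + dot p (n u) * dot q (n u)
            + dot p (z u) * dot q (z u).
Proof.
  intros hu; apply dot_frame;
    [now apply dot_e_e | now apply dot_n_n | now apply dot_e_n].
Qed.

Lemma dot_dn_e u : D u -> dot (cderive n u) (e u) = - 1.
Proof.
  intros hu.
  pose proof (dot_const_derive e n 0 u _ _ hu dot_e_n (is_cderive_e u hu) (is_cderive_n u hu)) as h.
  rewrite dot_n_n, (dot_comm (e u)) in h by assumption; lra.
Qed.

Lemma dot_dn_n u : D u -> dot (cderive n u) (n u) = 0.
Proof.
  intros hu.
  pose proof (dot_const_derive n n 1 u _ _ hu dot_n_n (is_cderive_n u hu) (is_cderive_n u hu)) as h.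
  rewrite (dot_comm (n u)) in h; lra.
Qed.

Lemma dot_dn_z u : dot (cderive n u) (z u) = kappa u.
Proof. unfold z, kappa, conical_curvature; fold n; unfold det3, dot, cross; cbn; ring. Qed.

(** The Frenet equation [n' = - e + kappa z], paired with a vector. *)
Lemma dot_dn u (c : R3) : D u ->
  dot (cderive n u) c = - dot (e u) c + kappa u * dot (z u) c.
Proof.
  intros hu.
  rewrite (dot_frame_at u (cderive n u) c) by assumption.
  rewrite dot_dn_e, dot_dn_n, dot_dn_z by assumption.
  rewrite (dot_comm c (e u)), (dot_comm c (z u)); ring.
Qed.

Lemma dot_ds_n u : D u -> dot (cderive s u) (n u) = 0.
Proof. exact (skew_striction _ _ _ Phi u). Qed.

(** The defining relation [s' = delta (lambda e + z)] of [lambda], with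
    [delta lambda] written as [s'.e]. *)
Lemma dot_ds u (c : R3) : D u ->
  dot (cderive s u) c = dot (cderive s u) (e u) * dot (e u) c + delta u * dot (z u) c.
Proof.
  intros hu.
  rewrite (dot_frame_at u (cderive s u) c) by assumption.
  rewrite dot_ds_n by assumption.
  change (dot (cderive s u) (z u)) with (delta u).
  rewrite (dot_comm c (e u)), (dot_comm c (z u)); ring.
Qed.

Lemma dot_dds_n u : D u ->
  dot (cderive (cderive s) u) (n u) = dot (cderive s u) (e u) - kappa u * delta u.
Proof.
  intros hu.
  pose proof (dot_const_derive (cderive s) n 0 u _ _ hu dot_ds_n
                (is_cderive_ds u hu) (is_cderive_n u hu)) as h.
  rewrite (dot_comm (cderive s u)), dot_dn in h by assumption.
  rewrite (dot_comm (z u)) in h.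
  change (dot (cderive s u) (z u)) with (delta u) in h.
  rewrite (dot_comm (e u)) in h; lra.
Qed.

(** In [delta' = s''.z + s'.z'] the second term vanishes, because [z'] is a
    multiple of n and the curve s is the line of striction. *)
Lemma is_derive_delta u : D u ->
  is_derive delta u (dot (cderive (cderive s) u) (z u)).
Proof.
  intros hu; evar_last.
  - apply (is_derive_dot (cderive s) z); [now apply is_cderive_ds|].
    apply is_cderive_cross; [now apply is_cderive_e | now apply is_cderive_n].
  - rewrite dot_ds by assumption.
    assert (h1 : dot (e u) (plus (cross (n u) (n u)) (cross (e u) (cderive n u))) = 0)
      by (vec_unfold; ring).
    assert (h2 : dot (z u) (plus (cross (n u) (n u)) (cross (e u) (cderive n u)))
      = dot (e u) (e u) * dot (cderive n u) (n u) - dot (e u) (cderive n u) * dot (e u) (n u))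
      by (unfold z; vec_unfold; ring).
    rewrite h1, h2, dot_dn_n, dot_e_n by assumption; ring.
Qed.

Lemma delta_neq0 u : D u -> delta u <> 0.
Proof. exact (skew_nontorsal _ _ _ Phi u). Qed.

(** * Fundamental forms and curvature *)

Let x := ruled s e.

Lemma ruled_u u v : D u -> vpartial U1 x u v = plus (cderive s u) (scal v (n u)).
Proof.
  intros hu; apply (is_cderive_unique (fun t => x t v)).
  apply is_cderive_plus; [now apply is_cderive_s|].
  now apply is_cderive_scal, is_cderive_e.
Qed.

Lemma ruled_v u v : vpartial U2 x u v = e u.
Proof. apply (is_cderive_unique (fun t => x u t)), is_cderive_line. Qed.

Lemma ruled_uu u v : D u ->
  vpartial U1 (vpartial U1 x) u v
  = plus (cderive (cderive s) u) (scal v (cderive n u)).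
Proof.
  intros hu; apply (is_cderive_unique (fun t => vpartial U1 x t v)).
  apply is_cderive_ext_loc with (c := fun t => plus (cderive s t) (scal v (n t))).
  - apply (filter_imp D); [|now apply D_open].
    intros t ht; symmetry; now apply ruled_u.
  - apply is_cderive_plus; [now apply is_cderive_ds|].
    now apply is_cderive_scal, is_cderive_n.
Qed.

Lemma ruled_uv u v : D u -> vpartial U1 (vpartial U2 x) u v = n u.
Proof.
  intros hu; apply (is_cderive_unique (fun t => vpartial U2 x t v)).
  apply is_cderive_ext_loc with (c := e); [|now apply is_cderive_e].
  apply filter_forall; intros t; symmetry; apply ruled_v.
Qed.

Lemma ruled_vu u v : D u -> vpartial U2 (vpartial U1 x) u v = n u.
Proof.
  intros hu; apply (is_cderive_unique (fun t => vpartial U1 x u t)).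
  apply is_cderive_ext_loc with (c := fun t => plus (cderive s u) (scal t (n u))).
  - apply filter_forall; intros t; symmetry; now apply ruled_u.
  - apply is_cderive_line.
Qed.

Lemma ruled_vv u v : vpartial U2 (vpartial U2 x) u v = zero.
Proof.
  apply (is_cderive_unique (fun t => vpartial U2 x u t)).
  apply is_cderive_ext_loc with (c := fun _ => e u); [|apply is_cderive_const].
  apply filter_forall; intros t; symmetry; apply ruled_v.
Qed.

(** The normal vector is [delta n - v z], paired with a vector. *)
Lemma dot_normal_vec u v (c : R3) : D u ->
  dot (normal_vec x u v) c = delta u * dot (n u) c - v * dot (z u) c.
Proof.
  intros hu; unfold normal_vec; rewrite ruled_u, ruled_v by assumption.
  assert (id : dot (cross (plus (cderive s u) (scal v (n u))) (e u)) c
     = dot (cderive s u) (cross (e u) c) - v * dot (z u) c) by (unfold z; vec_unfold; ring).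
  rewrite id, dot_ds by assumption.
  assert (h1 : dot (e u) (cross (e u) c) = 0) by (vec_unfold; ring).
  assert (h2 : dot (z u) (cross (e u) c)
    = dot (e u) (e u) * dot (n u) c - dot (e u) (n u) * dot (e u) c)
    by (unfold z; vec_unfold; ring).
  rewrite h1, h2, dot_e_e, dot_e_n by assumption; ring.
Qed.

Lemma dot_z_n u : dot (z u) (n u) = 0.
Proof. unfold z; vec_unfold; ring. Qed.

Lemma dot_z_z u : D u -> dot (z u) (z u) = 1.
Proof.
  intros hu.
  assert (h : dot (z u) (z u) = dot (e u) (e u) * dot (n u) (n u)
     - dot (e u) (n u) * dot (e u) (n u)) by (unfold z; vec_unfold; ring).
  rewrite h, dot_e_e, dot_n_n, dot_e_n by assumption; ring.
Qed.

Lemma normal_vec_sqr u v : D u ->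
  dot (normal_vec x u v) (normal_vec x u v) = v ^ 2 + delta u ^ 2.
Proof.
  intros hu; rewrite dot_normal_vec by assumption.
  rewrite (dot_comm (n u)), (dot_comm (z u)), !dot_normal_vec by assumption.
  rewrite (dot_comm (n u) (z u)), dot_z_n, dot_n_n, dot_z_z by assumption; ring.
Qed.

Let w u v := enorm (normal_vec x u v).

Lemma w_sqr u v : D u -> w u v ^ 2 = v ^ 2 + delta u ^ 2.
Proof.
  intros hu; rewrite <- normal_vec_sqr by assumption.
  rewrite <- Rsqr_pow2; apply Rsqr_sqrt; unfold dot; nra.
Qed.

Lemma w_neq0 u v : D u -> w u v <> 0.
Proof.
  intros hu h0; pose proof (w_sqr u v hu) as h; rewrite h0 in h.
  pose proof (delta_neq0 u hu); nra.
Qed.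

Lemma second_form_dot u v i j : second_form x u v i j
  = / w u v * dot (normal_vec x u v) (vpartial i (vpartial j x) u v).
Proof. apply dot_scal_l. Qed.

Lemma second_form_uu u v : D u ->
  second_form x u v U1 U1 =
  (delta u * (dot (cderive s u) (e u) - kappa u * delta u)
   - v * (dot (cderive (cderive s) u) (z u) + v * kappa u)) / w u v.
Proof.
  intros hu; rewrite second_form_dot, dot_normal_vec, ruled_uu by assumption.
  rewrite !(dot_comm _ (plus _ _)), !dot_plus_l, !dot_scal_l.
  rewrite dot_dds_n, dot_dn_n, dot_dn_z by assumption; unfold Rdiv; ring.
Qed.

Lemma second_form_uv u v : D u -> second_form x u v U1 U2 = delta u / w u v.
Proof.
  intros hu; rewrite second_form_dot, dot_normal_vec, ruled_uv by assumption.
  rewrite dot_n_n, dot_z_n by assumption; unfold Rdiv; ring.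
Qed.

Lemma second_form_vu u v : D u -> second_form x u v U2 U1 = delta u / w u v.
Proof.
  intros hu; rewrite second_form_dot, dot_normal_vec, ruled_vu by assumption.
  rewrite dot_n_n, dot_z_n by assumption; unfold Rdiv; ring.
Qed.

Lemma second_form_vv u v : second_form x u v U2 U2 = 0.
Proof. rewrite second_form_dot, ruled_vv, dot_zero_r; ring. Qed.

(** Lagrange's identity: the Gram determinant of the partial derivatives is
    the squared length of their cross product. *)
Lemma pdet_first_form u v : D u -> pdet (first_form x u v) = w u v ^ 2.
Proof.
  intros hu; rewrite w_sqr, <- normal_vec_sqr by assumption.
  unfold pdet, first_form, normal_vec, dot, cross; cbn; ring.
Qed.

Lemma abs_gauss_curvature u v : D u ->
  Rabs (gauss_curvature x u v) = delta u ^ 2 / (v ^ 2 + delta u ^ 2) ^ 2.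
Proof.
  intros hu; pose proof (w_neq0 u v hu) as hw.
  unfold gauss_curvature; rewrite pdet_first_form by assumption; unfold pdet.
  rewrite second_form_uv, second_form_vu, second_form_vv, <- w_sqr by assumption.
  replace (_ / w u v ^ 2) with (- (delta u ^ 2 / (w u v ^ 2) ^ 2)) by (field; exact hw).
  rewrite Rabs_Ropp; apply Rabs_pos_eq.
  apply Rle_mult_inv_pos; [nra|].
  assert (0 < w u v ^ 2) by nra; nra.
Qed.

(** * The relative normals *)

Variable alpha : R.

Let q u v := support x alpha u v.

Lemma support_ruled u v : D u ->
  q u v = Rpower (delta u ^ 2 / (v ^ 2 + delta u ^ 2) ^ 2) alpha.
Proof. intros hu; unfold q, support; now rewrite abs_gauss_curvature. Qed.

Lemma abs_gauss_curvature_pos u v : D u ->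
  0 < delta u ^ 2 / (v ^ 2 + delta u ^ 2) ^ 2.
Proof.
  intros hu; pose proof (delta_neq0 u hu).
  assert (0 < delta u ^ 2) by nra.
  apply Rdiv_lt_0_compat; nra.
Qed.

Lemma support_u u v : D u ->
  partial U1 (support x alpha) u v
  = alpha * (2 / delta u - 4 * delta u / w u v ^ 2)
    * dot (cderive (cderive s) u) (z u) * q u v.
Proof.
  intros hu; pose proof (delta_neq0 u hu) as hd.
  assert (hw : 0 < v ^ 2 + delta u ^ 2) by nra.
  cbn [partial].
  rewrite (Derive_ext_loc _ (fun t => Rpower (delta t ^ 2 / (v ^ 2 + delta t ^ 2) ^ 2) alpha)).
  2: { apply (filter_imp D); [|now apply D_open]. intros t ht; now apply support_ruled. }
  apply is_derive_unique; evar_last.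
  - apply is_derive_Rpower; [|now apply abs_gauss_curvature_pos].
    apply (is_derive_comp (fun y => y ^ 2 / (v ^ 2 + y ^ 2) ^ 2) delta);
      [|now apply is_derive_delta].
    auto_derive; [|reflexivity].
    apply (pow_nonzero (v ^ 2 + delta u ^ 2) 2); lra.
  - rewrite (support_ruled u v), w_sqr by assumption.
    unfold scal; cbn; unfold mult; cbn; field.
    repeat split; lra.
Qed.

Lemma support_v u v : D u ->
  partial U2 (support x alpha) u v = - (4 * alpha * v / w u v ^ 2) * q u v.
Proof.
  intros hu; pose proof (delta_neq0 u hu) as hd.
  assert (hw : 0 < v ^ 2 + delta u ^ 2) by nra.
  cbn [partial].
  rewrite (Derive_ext _ (fun t => Rpower (delta u ^ 2 / (t ^ 2 + delta u ^ 2) ^ 2) alpha))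
    by (intros t; now apply support_ruled).
  apply is_derive_unique; evar_last.
  - apply (is_derive_Rpower (fun t => delta u ^ 2 / (t ^ 2 + delta u ^ 2) ^ 2));
      [|now apply abs_gauss_curvature_pos].
    auto_derive; [|reflexivity].
    apply (pow_nonzero (v ^ 2 + delta u ^ 2) 2); lra.
  - rewrite (support_ruled u v), w_sqr by assumption.
    field; repeat split; lra.
Qed.

(** Since [h_vv = 0], the inverse of the second fundamental form has no
    (u,u) entry, its mixed entries are [w / delta], and its (v,v) entry is
    [- w^2 h_uu / delta^2].  The invariant [lambda] occurs in [h_uu] and in
    [x_u.c]; the two occurrences cancel, because both are multiplied by
    [q_v c1].  In place of [delta'] stands [s''.z], by [is_derive_delta]. *)
Lemma dot_relative_normal u v (c : R3) : D u ->
  dot (relative_normal x alpha u v) c * (delta u ^ 2 * w u v) =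
  q u v *
  (2 * alpha * (v ^ 2 + delta u ^ 2)
     * (dot (cderive (cderive s) u) (z u) + 2 * kappa u * v) * dot (e u) c
   + delta u * (4 * alpha * v ^ 2 + delta u ^ 2) * dot (n u) c
   + delta u ^ 2 * (4 * alpha - 1) * v * dot (z u) c).
Proof.
  intros hu; pose proof (delta_neq0 u hu) as hd; pose proof (w_neq0 u v hu) as hw.
  unfold relative_normal, psum, pinv, pdet, unit_normal.
  fold (w u v); fold (q u v).
  rewrite !dot_plus_l, !dot_opp_l, !dot_plus_l, !dot_scal_l.
  rewrite support_u, support_v, second_form_uu, second_form_uv, second_form_vu,
    second_form_vv, ruled_u, ruled_v, dot_normal_vec by assumption.
  rewrite dot_plus_l, dot_scal_l, (dot_ds u c) by assumption.
  pose proof (w_sqr u v hu) as hW.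
  generalize dependent (w u v); intros W hw hW.
  field_simplify_eq; [|tauto].
  (* Only the term coming from [q_u] still contains [w^2]. *)
  replace (W ^ 3) with (W * (v ^ 2 + delta u ^ 2)) by (rewrite <- hW; ring).
  ring.
Qed.

Lemma support_pos u v : 0 < q u v.
Proof. apply exp_pos. Qed.

(** Comparison of the coefficients of P.  The one of [v^0], divided by
    [delta^2], is [2 alpha delta' c1 + delta c2], and the one of [v^2] is
    [2 alpha delta' c1 + 4 alpha delta c2]; their difference isolates
    [(4 alpha - 1) delta c2]. *)
Lemma relative_normal_orthogonal u (c : R3) : D u ->
  (forall v, dot (relative_normal x alpha u v) c = 0) ->
  alpha * kappa u * dot (e u) c = 0 /\
  2 * alpha * dot (cderive (cderive s) u) (z u) * dot (e u) c
    + delta u * dot (n u) c = 0 /\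
  (4 * alpha - 1) * dot (n u) c = 0 /\
  (4 * alpha - 1) * dot (z u) c = 0.
Proof.
  intros hu h; pose proof (delta_neq0 u hu) as hd.
  set (dd := dot (cderive (cderive s) u) (z u)).
  destruct (cubic_zero
    (2 * alpha * delta u ^ 2 * dd * dot (e u) c + delta u ^ 3 * dot (n u) c)
    (delta u ^ 2 * (4 * alpha * kappa u * dot (e u) c + (4 * alpha - 1) * dot (z u) c))
    (2 * alpha * dd * dot (e u) c + 4 * alpha * delta u * dot (n u) c)
    (4 * (alpha * kappa u * dot (e u) c))) as (h0 & h1 & h2 & h3).
  { (* q is positive, so P itself vanishes. *)
    intros v; pose proof (dot_relative_normal u v c hu) as hP.
    rewrite h, Rmult_0_l in hP; fold dd in hP.
    symmetry in hP; apply Rmult_integral in hP as [hq|hP].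
    - pose proof (support_pos u v); lra.
    - rewrite <- hP; ring. }
  assert (h3' : alpha * kappa u * dot (e u) c = 0) by lra.
  split; [exact h3'|].
  assert (h0' : 2 * alpha * dd * dot (e u) c + delta u * dot (n u) c = 0).
  { apply (Rmult_eq_reg_l (delta u ^ 2)); [|now apply pow_nonzero].
    rewrite Rmult_0_r, <- h0; ring. }
  split; [exact h0'|]; split.
  - apply (Rmult_eq_reg_l (delta u)); [|assumption]. lra.
  - apply (Rmult_eq_reg_l (delta u ^ 2)); [|now apply pow_nonzero].
    rewrite Rmult_0_r, <- h1.
    replace (4 * alpha * kappa u * dot (e u) c)
      with (4 * (alpha * kappa u * dot (e u) c)) by ring.
    rewrite h3'; ring.
Qed.

(** This is [c2' = - c1 + kappa c3], read where [c2] vanishes. *)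
Lemma dot_n_locally_zero u (c : R3) : D u ->
  locally u (fun t => dot (n t) c = 0) ->
  kappa u * dot (z u) c = dot (e u) c.
Proof.
  intros hu h.
  assert (h' : dot (cderive n u) c + dot (n u) zero = 0).
  { apply (is_derive_const_loc _ _ _ _ h).
    apply (is_derive_dot n (fun _ => c));
      [now apply is_cderive_n | apply is_cderive_const]. }
  rewrite dot_zero_r, dot_dn in h' by assumption; lra.
Qed.

(** The third derivative of e exists, so [kappa] is even differentiable. *)
Lemma continuous_kappa u : D u -> continuous kappa u.
Proof.
  intros hu; apply (@ex_derive_continuous R_AbsRing R_NormedModule).
  eexists; apply (is_derive_dot e (fun t => cross (n t) (cderive n t)));
    [now apply is_cderive_e|].
  apply is_cderive_cross; [now apply is_cderive_n | now apply is_cderive_dn].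
Qed.

Lemma frame_neq_zero u (c : R3) : D u -> c <> zero ->
  dot (e u) c = 0 -> dot (n u) c = 0 -> dot (z u) c = 0 -> False.
Proof.
  intros hu hc h1 h2 h3; apply hc, (frame_zero (e u) (n u));
    rewrite 1?dot_comm; trivial.
  - now apply dot_e_e.
  - now apply dot_n_n.
  - rewrite dot_comm; now apply dot_e_n.
Qed.

(** * Relative normals parallel to a plane *)

Variable c : R3.
Hypothesis c_neq0 : c <> zero.
Hypothesis c_orth : forall u v, D u -> dot (relative_normal x alpha u v) c = 0.

Lemma parallel_alpha u : D u -> alpha = 1 / 4.
Proof.
  intros hu; destruct (Req_dec alpha (1 / 4)) as [ha|ha]; [exact ha|exfalso].
  assert (ha' : 4 * alpha - 1 <> 0) by lra.
  assert (hn : forall t, D t -> dot (n t) c = 0 /\ dot (z t) c = 0).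
  { intros t ht.
    destruct (relative_normal_orthogonal t c ht (fun v => c_orth t v ht))
      as (_ & _ & h2 & h3).
    split; [apply Rmult_integral in h2 | apply Rmult_integral in h3]; tauto. }
  destruct (hn u hu) as [h2 h3].
  apply (frame_neq_zero u c hu c_neq0); [|assumption|assumption].
  rewrite <- dot_n_locally_zero, h3; [ring|assumption|].
  apply (filter_imp D); [apply hn | now apply D_open].
Qed.

Lemma parallel_kappa u : D u -> kappa u = 0.
Proof.
  intros hu; destruct (Req_dec (kappa u) 0) as [hk|hk]; [exact hk|exfalso].
  pose proof (parallel_alpha u hu) as ha.
  assert (hen : forall t, D t -> kappa t <> 0 -> dot (e t) c = 0 /\ dot (n t) c = 0).
  { intros t ht hkt.
    destruct (relative_normal_orthogonal t c ht (fun v => c_orth t v ht))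
      as (h1 & h2 & _).
    rewrite ha in h1, h2.
    assert (he : dot (e t) c = 0).
    { apply Rmult_integral in h1 as [h1|h1]; [|exact h1].
      apply Rmult_integral in h1 as [h1|h1]; lra. }
    split; [exact he|].
    rewrite he, Rmult_0_r, Rplus_0_l in h2.
    apply Rmult_integral in h2 as [h2|h2]; [|exact h2].
    now destruct (delta_neq0 t ht). }
  destruct (hen u hu hk) as [he hn].
  apply (frame_neq_zero u c hu c_neq0 he hn).
  apply (Rmult_eq_reg_l (kappa u)); [|exact hk].
  rewrite Rmult_0_r, dot_n_locally_zero; [exact he|exact hu|].
  apply (filter_imp (fun t => D t /\ kappa t <> 0)).
  - intros t [ht hkt]; now apply hen.
  - apply filter_and; [now apply D_open|].
    exact (continuous_kappa u hu _ (open_neq 0 _ hk)).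
Qed.

End SkewRuled.

Lemma between_Rbar_open (a b : Rbar) : open (between_Rbar a b).
Proof. apply open_and; [apply open_Rbar_gt | apply open_Rbar_lt]. Qed.

Lemma between_Rbar_nonempty (a b : Rbar) :
  Rbar_lt a b -> exists u, between_Rbar a b u.
Proof.
  unfold between_Rbar; destruct a as [a| |], b as [b| |]; cbn; intros hab; try easy.
  - exists ((a + b) / 2); lra.
  - exists (a + 1); lra.
  - exists (b - 1); lra.
  - now exists 0.
Qed.

Theorem proposition1 (a b : Rbar) (s e : R -> R3) (alpha : R)
    (hab : Rbar_lt a b)
    (hPhi : skew_ruled_C3 (between_Rbar a b) s e)
    (hpar : normals_parallel_to_plane (between_Rbar a b) (ruled s e) alpha) :
  alpha = 1 / 4 /\ conoidal (between_Rbar a b) e.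
Proof.
  destruct hpar as (c & hc & horth).
  pose proof (between_Rbar_open a b) as hopen.
  destruct (between_Rbar_nonempty a b hab) as [u0 hu0].
  split.
  - now apply (parallel_alpha _ s e hopen hPhi alpha c hc horth u0).
  - intros u hu.
    now apply (parallel_kappa _ s e hopen hPhi alpha c hc horth u).
Qed.
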